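(* Every type $\mathrm{II}_1$ factor $\mathcal{M}$ contains a (unital) von Neumann subalgebra $\mathcal{B}$ that is regular in $\mathcal{M}$ but not unitarily regular in $\mathcal{M}$.
   Context: For a unital inclusion of von Neumann algebras $\mathcal{B}\subseteq\mathcal{M}$ (i.e. $1_{\mathcal{B}}=1_{\mathcal{M}}$), put $\mathcal{N}_{\mathcal{M}}(\mathcal{B})=\{n\in\mathcal{M}: n\mathcal{B}n^*\cup n^*\mathcal{B}n\subseteq\mathcal{B}\}$ (the normaliser) and $\mathcal{UN}_{\mathcal{M}}(\mathcal{B})=\{u\in\mathcal{M}\text{ unitary}: u\mathcal{B}u^*=\mathcal{B}\}$ (the unitary normaliser). $W^*(S)$ denotes the von Neumann subalgebra of $\mathcal{M}$ generated by $S$. $\mathcal{B}$ is regular in $\mathcal{M}$ if $W^*(\mathcal{N}_{\mathcal{M}}(\mathcal{B}))=\mathcal{M}$ and unitarily regular in $\mathcal{M}$ if $W^*(\mathcal{UN}_{\mathcal{M}}(\mathcal{B}))=\mathcal{M}$. *)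

(* Defs.v *)
From mathcomp Require Import all_boot all_order all_algebra.
From mathcomp Require Import complex.
From mathcomp Require Import boolp classical_sets functions reals.
From mathcomp Require Import topology normedtype.

Set Implicit Arguments.
Unset Strict Implicit.
Unset Printing Implicit Defensive.

Import Order.TTheory GRing.Theory Num.Theory.
Import numFieldNormedType.Exports.

Local Open Scope classical_set_scope.
Local Open Scope ring_scope.

(* The inner product is linear in its first argument and conjugate-linear in
   its second one; no dimension or separability assumption is made. *)
Record hilbertType (R : realType) := HilbertType {
  hilbert_sort :> completeNormedModType R[i];
  inner : {dot hilbert_sort for (@Num.conj R[i])};
  inner_normE : forall x : hilbert_sort, `|x| ^+ 2 = inner x x }.

Section VonNeumannAlgebras.
Variables (R : realType) (H : hilbertType R).
Implicit Types (a b e p q u v n x : H -> H) (S M N B : set (H -> H)).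

Definition bounded_operator a := linear a /\ continuous a.

(* By the Riesz representation theorem exactly one [b] qualifies when [a] is a
   bounded operator; the default value [0] is irrelevant in that case. *)
Definition adj a : H -> H :=
  xget 0 [set b | bounded_operator b /\
                  forall y z : H, inner H (a y) z = inner H y (b z)].

Definition commutant S : set (H -> H) :=
  [set a | bounded_operator a /\ forall b, S b -> a \o b = b \o a].

(* Concrete von Neumann algebras on [H], in the bicommutant form; the last
   condition forces [M] to consist of bounded operators and to contain [id],
   which is the unit of [M]. *)
Definition von_neumann M :=
  (forall a, M a -> M (adj a)) /\ M = commutant (commutant M).

(* Such an [N] contains [id], hence has the same unit as [M]. *)
Definition von_neumann_subalgebra N M := von_neumann N /\ N `<=` M.

Definition generated_von_neumann M S : set (H -> H) :=
  smallest [set N | von_neumann_subalgebra N M] S.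

Definition factor M :=
  [/\ von_neumann M,
      exists y : H, y != 0 &
      M `&` commutant M = [set a | exists c : R[i], a = (fun y => c *: y)]].

Definition projection M p := [/\ M p, adj p = p & p \o p = p].

Definition subprojection M q p := projection M q /\ p \o q = q.

Definition mv_equivalent M p q :=
  exists v, [/\ M v, adj v \o v = p & v \o adj v = q].

Definition finite_projection M p :=
  projection M p /\
  forall q, subprojection M q p -> mv_equivalent M p q -> q = p.

Definition minimal_projection M e :=
  [/\ projection M e, e <> 0 &
      forall q, subprojection M q e -> q = 0 \/ q = e].

(* Murray and von Neumann: a factor is of type II_1 when it has no minimal
   projection and its unit is finite. *)
Definition type_II1_factor M :=
  [/\ factor M, ~ (exists e, minimal_projection M e) &
      finite_projection M id].

Definition normaliser M B : set (H -> H) :=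
  [set n | M n /\
    [set n \o b \o adj n | b in B] `|` [set adj n \o b \o n | b in B] `<=` B].

Definition unitary u := adj u \o u = id /\ u \o adj u = id.

Definition unitary_normaliser M B : set (H -> H) :=
  [set u | [/\ M u, unitary u & [set u \o b \o adj u | b in B] = B]].

Definition regular M B := generated_von_neumann M (normaliser M B) = M.

Definition unitarily_regular M B :=
  generated_von_neumann M (unitary_normaliser M B) = M.

End VonNeumannAlgebras.

(* Main.v *)
Require Import Defs.
From mathcomp Require Import all_boot all_order all_algebra.
From mathcomp Require Import complex.
From mathcomp Require Import boolp classical_sets functions reals.
From mathcomp Require Import topology normedtype.
From HB Require Import structures.
From mathcomp Require Import ring lra.

(** Write [1] for the identity of the II_1 factor [M], let [p] be a projection
    of [M] other than [0] and [1], and let [B] be the algebra of those elements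
    of [M] that commute with [p], that is, the block diagonal algebra
    [pMp + (1-p)M(1-p)].

    [B] is regular.  If [q] and [r] are each [p] or [1-p], then an element
    [n = qar] of a corner of [M] satisfies [n B n* <= qMq <= B] and
    [n* B n <= rMr <= B], so every corner consists of normalisers
    ([corner_normaliser]), and each element of [M] is the sum of its four
    corners.

    Suppose moreover that no unitary of [M] conjugates [p] to [1-p].  If a
    unitary [u] of [M] satisfies [u B u* = B], then [e = u p u*] is a projection
    in the centre of [B].  As [M] is a factor, the corners [pMp] and
    [(1-p)M(1-p)] are factors too, so that [e] is [0], [1], [p] or [1-p]
    ([relative_commutant_central]); only [e = p] survives, hence [u] commutes
    with [p].  All unitary normalisers thus lie in [B], and [B] is not [M],
    since otherwise [p] would be a nontrivial central projection of [M].

    Such a [p] exists ([ex_asymmetric_projection]).  As [M] has no minimal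
    projection, there are projections [0 < r < q < 1].  If both [q] and [r] were unitarily conjugate to their
    complements, then [q] would be conjugate to [1-q], which sits below [1-r],
    which is conjugate to [r]; so a unitary would carry [q] below [r], properly
    inside itself, and completing it by [1-q] would produce a nonunitary
    isometry of [M], against finiteness ([no_unitary_into_smaller]).

    That a corner of a factor is a factor rests on [factor_prime]: [zMw = 0]
    forces [z = 0] or [w = 0], because the orthogonal complement of [MwH] is
    invariant under [M] and its commutant, so that the projection onto it is
    scalar.  The Hilbert space facts behind this are the projection theorem
    ([orthogonal_decomposition]) and the existence of adjoints, which comes from
    Riesz representation ([riesz]). *)

Set Implicit Arguments.
Unset Strict Implicit.
Unset Printing Implicit Defensive.

Import Order.TTheory GRing.Theory Num.Theory.
Import numFieldNormedType.Exports.

Local Open Scope classical_set_scope.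
Local Open Scope complex_scope.
Local Open Scope ring_scope.

(** * The underlying real inner product *)

Section RealInnerProduct.
Variables (R : realType) (H : hilbertType R).
Implicit Types (x y z : H) (t c e s : R) (k : R[i]).

(** The scalars [R[i]] carry only a partial order, so all estimates are made in
    the real Hilbert space underlying [H], whose inner product this is. *)
Definition rip x y : R := complex.Re (inner H x y).
Definition sqn x : R := rip x x.

Lemma innerC x y : inner H x y = (inner H y x)^*%R.
Proof. by rewrite hermC mul1r. Qed.

Lemma innerDl x y z : inner H (x + y) z = inner H x z + inner H y z.
Proof. exact: linearDl. Qed.

Lemma innerDr x y z : inner H x (y + z) = inner H x y + inner H x z.
Proof. exact: linearDr. Qed.

Lemma innerZl k x y : inner H (k *: x) y = k * inner H x y.
Proof. exact: linearZl_LR. Qed.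

Lemma innerZr k x y : inner H x (k *: y) = k^*%R * inner H x y.
Proof. exact: linearZr_LR. Qed.

Lemma inner0l x : inner H 0 x = 0.
Proof. exact: linear0l. Qed.

Lemma inner0r x : inner H x 0 = 0.
Proof. exact: linear0r. Qed.

Lemma innerBl x y z : inner H (x - y) z = inner H x z - inner H y z.
Proof. exact: linearBl. Qed.

Lemma innerBr x y z : inner H x (y - z) = inner H x y - inner H x z.
Proof. exact: linearBr. Qed.

Lemma ripC x y : rip x y = rip y x.
Proof.
by rewrite /rip innerC; apply: complexI; rewrite !complexRe Re_conj.
Qed.

Lemma ripDl x y z : rip (x + y) z = rip x z + rip y z.
Proof. by rewrite /rip innerDl raddfD. Qed.

Lemma ripBl x y z : rip (x - y) z = rip x z - rip y z.
Proof. by rewrite /rip innerBl raddfB. Qed.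

Lemma ripZl t x y : rip (t%:C *: x) y = t * rip x y.
Proof.
rewrite /rip innerZl; case: (inner H x y) => a b /=.
by rewrite mul0r subr0.
Qed.

Lemma ripDr x y z : rip x (y + z) = rip x y + rip x z.
Proof. by rewrite ripC ripDl !(ripC x). Qed.
Lemma ripBr x y z : rip x (y - z) = rip x y - rip x z.
Proof. by rewrite ripC ripBl !(ripC x). Qed.
Lemma ripZr t x y : rip x (t%:C *: y) = t * rip x y.
Proof. by rewrite ripC ripZl (ripC x). Qed.

Lemma innerxx x : inner H x x = (sqn x)%:C.
Proof.
by rewrite /sqn /rip RRe_real// -inner_normE realX// normr_real.
Qed.

Lemma sqn_ge0 x : 0 <= sqn x.
Proof. by rewrite -ler0c -innerxx -inner_normE exprn_ge0. Qed.

Lemma inner_eq0 x : inner H x x = 0 -> x = 0.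
Proof.
rewrite -inner_normE => /eqP; rewrite expf_eq0/= normr_eq0.
by move/eqP.
Qed.

Lemma gt0_complex k : 0 < k -> exists2 e, 0 < e & k = e%:C.
Proof.
move=> k0; exists (complex.Re k); last by rewrite RRe_real ?gtr0_real.
by rewrite -ltcR RRe_real ?gtr0_real.
Qed.

Lemma norm_lt_sqn x e : 0 < e -> (`|x| < e%:C) = (sqn x < e ^+ 2).
Proof.
move=> e0; rewrite -ltcR -innerxx -inner_normE rmorphXn/=.
by rewrite ltr_pXn2r// ?nnegrE// ler0c ltW.
Qed.

Lemma norm_le_sqn x y e : 0 <= e -> (`|x| <= e%:C * `|y|) = (sqn x <= e ^+ 2 * sqn y).
Proof.
move=> e0; rewrite -lecR rmorphM/= -!innerxx -!inner_normE rmorphXn/= -exprMn.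
by rewrite ler_pXn2r// ?nnegrE// mulr_ge0 ?ler0c.
Qed.

Lemma sqn_sub x y : sqn (x - y) = sqn (y - x).
Proof. by rewrite /sqn !ripBl !ripBr; ring. Qed.

Lemma sqnBZ t x y :
  sqn (x - t%:C *: y) = sqn x - 2 * t * rip x y + t ^+ 2 * sqn y.
Proof. by rewrite /sqn ripBl !ripBr !ripZl !ripZr (ripC y x); ring. Qed.

(** Positivity of [sqn (x - t y)].  It plays the part of the Cauchy-Schwarz
    inequality, and keeping [t] free avoids square roots. *)
Lemma rip_young t x y : 2 * t * rip x y <= sqn x + t ^+ 2 * sqn y.
Proof.
have := sqn_ge0 (x - t%:C *: y); rewrite sqnBZ; lra.
Qed.

Lemma lin_quad_eq0 c s : 0 <= s -> (forall t, 2 * t * c <= t ^+ 2 * s) -> c = 0.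
Proof.
(* [t = c / s] would be the natural choice; [s + 1] also covers [s = 0]. *)
move=> s0 /(_ (c / (s + 1))) h; have s1 : 0 < s + 1 by lra.
have : c ^+ 2 * (s + 2) <= 0.
  have := ler_wpM2r (exprn_ge0 2 (ltW s1)) h.
  have -> : 2 * (c / (s + 1)) * c * (s + 1) ^+ 2 = 2 * c ^+ 2 * (s + 1).
    by field; lra.
  have -> : (c / (s + 1)) ^+ 2 * s * (s + 1) ^+ 2 = c ^+ 2 * s.
    by field; lra.
  lra.
rewrite pmulr_lle0 ?ltr_wpDl// => c2; apply/eqP; rewrite -sqrf_eq0 eq_le c2/=.
exact: sqr_ge0.
Qed.

(** The form in which [rip_young] is used: a real inner product vanishes when,
    up to every [e > 0], it obeys the bound that an orthogonal pair does. *)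
Lemma small_eq0 c s : 0 <= s ->
  (forall t e, 0 < e -> 2 * t * c <= e + t ^+ 2 * s) -> c = 0.
Proof.
move=> s0 h; apply: (lin_quad_eq0 s0) => t; apply/ler_addgt0Pl => e e0.
exact: h.
Qed.

(** For [k = inner H x y], the real inner product of [x] with [k *: y] is the
    squared modulus of [k].  Real orthogonality to a complex subspace is thus
    orthogonality. *)
Lemma inner_rip0 x y : (forall k : R[i], rip x (k *: y) = 0) -> inner H x y = 0.
Proof.
move=> h; have := h (inner H x y); rewrite /rip innerZr mulrC -normCK.
move=> n0; apply/eqP; rewrite -normr_eq0 -sqrf_eq0.
by rewrite -(RRe_real (x := `|inner H x y| ^+ 2)) ?n0// realX ?normr_real.
Qed.

End RealInnerProduct.

(** * Closed subspaces and orthogonal decomposition *)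

Section Projection.
Variables (R : realType) (H : hilbertType R).
Implicit Types (x y z : H) (t e : R) (K : set H).

(** Topological closedness is written with [sqn], so that the estimates in the
    real inner product apply to it directly. *)
Definition closed_subspace K :=
  [/\ K 0, forall x y, K x -> K y -> K (x + y),
      forall (k : R[i]) x, K x -> K (k *: x) &
      forall y, (forall e, 0 < e -> exists2 z, K z & sqn (z - y) < e) -> K y].

(** The parallelogram law for [x - y] and [x - z], whose sum is twice the
    distance vector from [x] to the midpoint of [y] and [z]. *)
Lemma parallelogram x y z : sqn (y - z) =
  2 * sqn (x - y) + 2 * sqn (x - z) - 4 * sqn (x - (2^-1)%:C *: (y + z)).
Proof.
rewrite /sqn !ripBl !ripBr !ripZl !ripZr !ripDl !ripDr.
rewrite (ripC y x) (ripC z x) (ripC z y).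
by field.
Qed.

Section Minimise.
Variables (K : set H) (x : H).
Hypothesis HK : closed_subspace K.

Let dist2 : R := inf [set sqn (x - y) | y in K].
Let near_min e := [set y | K y /\ sqn (x - y) < dist2 + e].

Let dist2_has_inf : has_inf [set sqn (x - y) | y in K].
Proof.
split; first by exists (sqn (x - 0)), 0 => //; case: HK.
by exists 0 => _ [y _ <-]; exact: sqn_ge0.
Qed.

Let dist2_le y : K y -> dist2 <= sqn (x - y).
Proof. by move=> Ky; apply: ge_inf; [case: dist2_has_inf|exists y]. Qed.

Let near_min_ex e : 0 < e -> near_min e !=set0.
Proof.
move=> e0; have [_ [y Ky <-] lt_y] := inf_adherent e0 dist2_has_inf.
by exists y.
Qed.

Let near_min_close e y z : near_min e y -> near_min e z -> sqn (y - z) < 4 * e.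
Proof.
move=> [Ky ye] [Kz ze]; case: HK => _ KD KZ _.
have := dist2_le (KZ (2^-1)%:C _ (KD _ _ Ky Kz)).
rewrite (parallelogram x y z); lra.
Qed.

Let near_min_rip e y z t : near_min e y -> K z ->
  2 * t * rip (x - y) z <= e + t ^+ 2 * sqn z.
Proof.
move=> [Ky ye] Kz; case: HK => _ KD KZ _.
have := dist2_le (KD _ _ Ky (KZ t%:C _ Kz)); rewrite opprD addrA.
by move: ye; rewrite sqnBZ; lra.
Qed.

(** The sets [near_min e] shrink to a point by the parallelogram law
    ([near_min_close]), since midpoints stay in [K].  Orthogonality to [K] is
    already approximately true on [near_min e] ([near_min_rip]) because moving
    inside [K] cannot beat the infimum, and it passes to the limit. *)
Lemma orthogonal_decomposition :
  exists2 l, K l & forall y, K y -> inner H (x - l) y = 0.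
Proof.
pose F := filter_from [set e : R | 0 < e] near_min.
have FF : ProperFilter F.
  apply: filter_from_proper; last by move=> e /near_min_ex.
  apply: filter_from_filter; first by exists 1 => /=.
  move=> e e' /= e0 e0'; exists (Num.min e e'); first by rewrite /= lt_min e0.
  by move=> y [Ky ye]; split; split=> //; apply: (lt_le_trans ye);
    rewrite lerD2l ge_min lexx ?orbT.
have cF : cvg F.
  apply/cauchy_cvgP/cauchy_exP => _ /gt0_complex [e e0 ->].
  have e2 : 0 < e ^+ 2 / 4 by rewrite divr_gt0 ?exprn_gt0.
  have [y yF] := near_min_ex e2; exists y, (e ^+ 2 / 4) => // z zF.
  rewrite -ball_normE /= norm_lt_sqn//.
  by apply: lt_le_trans (near_min_close yF zF) _; lra.
have lP e : 0 < e -> exists2 y, near_min e y & sqn (y - lim F) < e.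
  move=> e0; have [y [ymin]] : (near_min e `&` ball (lim F) (Num.sqrt e)%:C) !=set0.
    apply: (@filter_ex _ F); apply: filterI; first by exists e.
    apply: (cF _); apply: nbhsx_ballx; by rewrite ltcR sqrtr_gt0.
  rewrite -ball_normE /= distrC norm_lt_sqn ?sqrtr_gt0// sqr_sqrtr ?ltW// => yl.
  by exists y.
exists (lim F).
  case: HK => _ _ _; apply => e /lP [y [Ky _] ?]; by exists y.
move=> y Ky; apply: inner_rip0 => k; have {}Ky : K (k *: y) by case: HK => _ _ + _; apply.
apply: (@small_eq0 _ _ (2 * sqn (k *: y))); first by have := sqn_ge0 (k *: y); lra.
move=> t e e0; have e2 : 0 < e / 2 by lra.
have [m mF ml] := lP _ e2.
have -> : x - lim F = (x - m) + (m - lim F) by rewrite addrA subrK.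
have := near_min_rip t mF Ky; have := rip_young t (m - lim F) (k *: y).
rewrite (ripDl (x - m)); move: ml; lra.
Qed.

End Minimise.
End Projection.

(** * Bounded operators and their adjoints *)

Section BoundedOperators.
Variables (R : realType) (H : hilbertType R).
Implicit Types (x y z : H) (a b : H -> H) (t e C : R) (k : R[i]).

Lemma bounded_sqn a : bounded_operator a <->
  linear a /\ exists2 C, 0 < C & forall x, sqn (a x) <= C * sqn x.
Proof.
pose L (la : linear a) := GRing.isLinear.Build _ _ _ _ a la.
split=> [[la ca]|[la [C C0 aC]]]; split=> //.
  pose f : {linear H -> H} := HB.pack a (L la).
  have /linear_bounded_continuous/linear_boundedP : continuous f by [].
  move=> /pinfty_ex_gt0 [_ /gt0_complex [r r0 ->] far].
  exists (r ^+ 2); first by rewrite exprn_gt0.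
  by move=> x; rewrite -norm_le_sqn ?(ltW r0)//; exact: far.
pose f : {linear H -> H} := HB.pack a (L la).
apply: (@bounded_linear_continuous _ _ _ f); apply/linear_boundedP.
exists (Num.sqrt C)%:C; split; first by rewrite ger0_real// ler0c sqrtr_ge0.
move=> r rC x; apply: (@le_trans _ _ ((Num.sqrt C)%:C * `|x|)).
  by rewrite norm_le_sqn ?sqrtr_ge0// sqr_sqrtr ?(ltW C0).
by rewrite ler_wpM2r// (ltW rC).
Qed.

Section Linear.
Variables (a : H -> H) (ba : bounded_operator a).

Lemma bopP k x y : a (k *: x + y) = k *: a x + a y.
Proof. by case: ba => la _; exact: la. Qed.
Lemma bop0 : a 0 = 0.
Proof. by have := bopP (-1) 0 0; rewrite scaleN1r oppr0 addr0 scaleN1r addNr. Qed.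
Lemma bopD x y : a (x + y) = a x + a y.
Proof. by have := bopP 1 x y; rewrite !scale1r. Qed.
Lemma bopZ k x : a (k *: x) = k *: a x.
Proof. by have := bopP k x 0; rewrite bop0 !addr0. Qed.
Lemma bopN x : a (- x) = - a x.
Proof. by rewrite -scaleN1r bopZ scaleN1r. Qed.
Lemma bopB x y : a (x - y) = a x - a y.
Proof. by rewrite bopD bopN. Qed.
End Linear.

Lemma bounded_id : bounded_operator (@id H).
Proof. by split=> // x; exact: cvg_id. Qed.

Lemma bounded_comp a b :
  bounded_operator a -> bounded_operator b -> bounded_operator (a \o b).
Proof.
move=> ba bb; split=> [k x y|x] /=; first by rewrite !bopP.
by apply: continuous_comp; [case: bb => _; apply|case: ba => _; apply].
Qed.

Lemma bounded_add a b :
  bounded_operator a -> bounded_operator b -> bounded_operator (a \+ b).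
Proof.
move=> ba bb; split=> [k x y|x] /=.
  by rewrite (bopP ba) (bopP bb) scalerDr addrACA.
by apply: continuousD; [case: ba => _; apply|case: bb => _; apply].
Qed.

Lemma bounded_scale k : bounded_operator (fun x : H => k *: x).
Proof.
split=> [l x y|x] /=; first by rewrite scalerDr !scalerA mulrC.
by apply: cvgZr; exact: cvg_id.
Qed.

Definition adjoint_pair a b := forall x y, inner H (a x) y = inner H x (b y).

Lemma inner_sepr x y : (forall z, inner H z x = inner H z y) -> x = y.
Proof.
by move=> h; apply/subr0_eq/inner_eq0; rewrite innerBr h subrr.
Qed.

Lemma adjoint_pairC a b : adjoint_pair a b -> adjoint_pair b a.
Proof. by move=> ab x y; rewrite innerC -ab -innerC. Qed.

Lemma adjoint_pair_inj a b b' : adjoint_pair a b -> adjoint_pair a b' -> b = b'.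
Proof. by move=> ab ab'; apply/funext => y; apply: inner_sepr => z; rewrite -ab ab'. Qed.

(** Riesz representation of the functional [y |-> inner H (a y) z].  Unless the
    functional vanishes, its kernel is a closed hyperplane, and a multiple of
    any nonzero vector [v] orthogonal to the kernel represents it. *)
Lemma riesz a z : bounded_operator a ->
  exists w, forall y, inner H (a y) z = inner H y w.
Proof.
move=> ba; pose f y := inner H (a y) z.
have fD x y : f (x + y) = f x + f y by rewrite /f bopD// innerDl.
have fZ k x : f (k *: x) = k * f x by rewrite /f bopZ// innerZl.
have fker : closed_subspace [set y | f y = 0].
  split=> /=.
  - by rewrite /f bop0// inner0l.
  - by move=> x y; rewrite fD => -> ->; rewrite addr0.
  - by move=> k x; rewrite fZ => ->; rewrite mulr0.
  move=> y yK; apply: inner_rip0 => k; apply: (small_eq0 (sqn_ge0 (k *: z))).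
  move=> t e e0; have [_ [C C0 aC]] := (bounded_sqn a).1 ba.
  have [w fw wy] := yK _ (divr_gt0 e0 C0).
  have -> : rip (a y) (k *: z) = rip (a (y - w)) (k *: z).
    by rewrite bopB// ripBl /rip [X in _ - complex.Re X]innerZr -/(f w) fw mulr0 subr0.
  apply: le_trans (rip_young _ _ _) _; rewrite lerD2r.
  apply: le_trans (aC _) _; rewrite mulrC -ler_pdivlMr//.
  by rewrite sqn_sub (ltW wy).
have [f0|/existsNP[x fx]] := pselect (forall y, f y = 0).
  by exists 0 => y; rewrite inner0r -/(f y) f0.
have [l fl lP] := orthogonal_decomposition x fker.
set v := x - l in lP.
have fv : f v != 0.
  by apply/eqP; rewrite /v -scaleN1r fD fZ fl mulr0 addr0.
have v0 : inner H v v != 0.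
  apply: contra_neq fv => /inner_eq0 ->.
  by rewrite /f bop0// inner0l.
(* [y - (f y / f v) v] lies in the kernel, so it is orthogonal to [v]. *)
exists ((f v / inner H v v)^*%R *: v) => y.
have : inner H v (y - (f y / f v) *: v) = 0.
  by apply: lP; rewrite /= -scaleNr fD fZ mulNr divfK// subrr.
rewrite innerC => /(congr1 (@Num.conj _)); rewrite conjCK rmorph0 innerBl innerZl.
move=> /subr0_eq yv; rewrite innerZr conjCK yv -/(f y).
by field; rewrite fv v0.
Qed.

(** If [sqn (a x) <= C * sqn x] for all [x], then [rip_young] with [t = C] bounds
    [2 * C * sqn (b z) = 2 * C * rip (a (b z)) z] by
    [C * sqn (b z) + C ^+ 2 * sqn z], which gives [sqn (b z) <= C * sqn z]. *)
Lemma adjoint_bounded a b : bounded_operator a -> adjoint_pair a b ->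
  bounded_operator b.
Proof.
move=> ba ab; apply/bounded_sqn; split.
  move=> k x y; apply: inner_sepr => z.
  by rewrite -ab !innerDr !innerZr -!ab.
have [_ [C C0 aC]] := (bounded_sqn a).1 ba.
exists C => // z; have := rip_young C (a (b z)) z.
have -> : rip (a (b z)) z = sqn (b z) by rewrite /rip ab.
have := aC (b z) => h1 h2.
have : C * sqn (b z) <= C * (C * sqn z) by lra.
by rewrite ler_pM2l.
Qed.

Lemma adj_ex a : bounded_operator a ->
  exists b, bounded_operator b /\ adjoint_pair a b.
Proof.
move=> ba; have /choice[b ab] := fun z => riesz z ba.
exists b; have {}ab : adjoint_pair a b by move=> x y; exact: ab.
by split=> //; exact: adjoint_bounded ab.
Qed.

Lemma adj_bounded_pair a : bounded_operator a ->
  bounded_operator (adj a) /\ adjoint_pair a (adj a).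
Proof.
move=> /adj_ex [b abP]; rewrite /adj; case: xgetP => [c _ //|/(_ b)].
by case.
Qed.

Lemma bounded_adj a : bounded_operator a -> bounded_operator (adj a).
Proof. by case/adj_bounded_pair. Qed.

Lemma adjP a : bounded_operator a -> adjoint_pair a (adj a).
Proof. by case/adj_bounded_pair. Qed.

Lemma adj_eq a b : bounded_operator a -> adjoint_pair a b -> adj a = b.
Proof. by move=> ba; apply/adjoint_pair_inj/adjP. Qed.

Lemma adjK a : bounded_operator a -> adj (adj a) = a.
Proof. by move=> ba; apply/adj_eq/adjoint_pairC/adjP => //; exact: bounded_adj. Qed.

Lemma adj_comp a b : bounded_operator a -> bounded_operator b ->
  adj (a \o b) = adj b \o adj a.
Proof.
move=> ba bb; apply: adj_eq; first exact: bounded_comp.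
by move=> x y /=; rewrite !adjP.
Qed.

Lemma adj_add a b : bounded_operator a -> bounded_operator b ->
  adj (a \+ b) = adj a \+ adj b.
Proof.
move=> ba bb; apply: adj_eq; first exact: bounded_add.
by move=> x y /=; rewrite innerDl innerDr !adjP.
Qed.

Lemma adj_id : adj (@id H) = id.
Proof. by apply: adj_eq => //; exact: bounded_id. Qed.

End BoundedOperators.

Section OrthogonalProjection.
Variables (R : realType) (H : hilbertType R).
Implicit Types (x y z : H) (c : H -> H) (K : set H).

(** Uniqueness of the orthogonal decomposition makes the projection linear, and
    makes it commute with operators that preserve [K] and its orthogonal
    complement; for the latter it suffices that the adjoint preserve [K]. *)
Lemma orthogonal_projection K : closed_subspace K ->
  exists P : H -> H, [/\ bounded_operator P, forall y, K (P y),
    forall y, K y -> P y = y &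
    forall c, bounded_operator c -> (forall y, K y -> K (c y)) ->
      (forall y, K y -> K (adj c y)) -> c \o P = P \o c].
Proof.
move=> HK; have [_ KD KZ _] := HK.
have /choice[P PP] : forall y, exists l,
    K l /\ forall z, K z -> inner H (y - l) z = 0.
  by move=> y; have [l Kl ly] := orthogonal_decomposition y HK; exists l.
have Puniq y l : K l -> (forall z, K z -> inner H (y - l) z = 0) -> P y = l.
  move=> Kl yl; have [KP yP] := PP y; apply/subr0_eq/inner_eq0.
  have KPl : K (P y - l) by apply: KD => //; rewrite -scaleN1r; exact: KZ.
  by rewrite -[X in inner H X _](subrKA y) addrC innerDl yl// -opprB -scaleN1r
    innerZl yP// mulr0 addr0.
exists P; split.
- apply/bounded_sqn; split.
    move=> k x y; apply: Puniq => [|z Kz].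
      by apply: KD; [apply: KZ|]; apply: (PP _).1.
    by rewrite opprD addrACA -scalerBr innerDl innerZl !(PP _).2// mulr0 addr0.
  exists 1 => // y; rewrite mul1r -{2}(subrK (P y) y).
  have : rip (y - P y) (P y) = 0.
    by rewrite /rip (PP y).2//; apply: (PP y).1.
  move: (y - P y) => d dP; rewrite /sqn ripDl !ripDr (ripC (P y) d) dP.
  by rewrite addr0 add0r lerDr; exact: sqn_ge0.
- by move=> y; apply: (PP y).1.
- by move=> y Ky; apply: Puniq => // z _; rewrite subrr inner0l.
- move=> c bc cK acK; apply/funext => y /=; apply/esym/Puniq => [|z Kz].
    exact/cK/(PP y).1.
  by rewrite -(bopB bc) adjP// (PP y).2//; exact: acK.
Qed.

End OrthogonalProjection.

(** * Commutants and von Neumann algebras *)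

Section Commutants.
Variables (R : realType) (H : hilbertType R).
Implicit Types (a b p : H -> H) (k : R[i]) (S M : set (H -> H)).

Lemma comp_app a b c (abc : a \o b = c) y : a (b y) = c y.
Proof. by rewrite -abc. Qed.

(** Boundedness is included because commutants consist of bounded operators, so
    that only then is [S] contained in its bicommutant. *)
Definition star_closed S := forall a, S a -> bounded_operator a /\ S (adj a).

Lemma commutant_comp S a b : commutant S a -> commutant S b ->
  commutant S (a \o b).
Proof.
move=> [ba aS] [bb bS]; split; first exact: bounded_comp.
by move=> c Sc; rewrite -compA bS// compA aS.
Qed.

Lemma commutant_add S a b : star_closed S -> commutant S a -> commutant S b ->
  commutant S (a \+ b).
Proof.
move=> hS [ba aS] [bb bS]; split; first exact: bounded_add.
move=> c Sc; apply/funext => y /=; have [bc _] := hS _ Sc.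
by rewrite (bopD bc) (comp_app (aS _ Sc)) (comp_app (bS _ Sc)).
Qed.

Lemma commutant_scale S k : star_closed S -> commutant S (fun x => k *: x).
Proof.
move=> hS; split; first exact: bounded_scale.
by move=> c Sc; apply/funext => y /=; have [bc _] := hS _ Sc; rewrite bopZ.
Qed.

Lemma star_closed_commutant S : star_closed S -> star_closed (commutant S).
Proof.
move=> hS a [ba aS]; split=> //; split; first exact: bounded_adj.
move=> b Sb; have [bb Sab] := hS _ Sb.
have := aS _ Sab => /(congr1 (@adj _ _)).
have ba' := bounded_adj bb.
by rewrite (adj_comp ba ba') (adj_comp ba' ba) (adjK bb).
Qed.

(** The first commutant equals the third one, so a commutant is its own
    bicommutant. *)
Lemma von_neumann_commutant S : star_closed S -> von_neumann (commutant S).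
Proof.
move=> hS; split=> [a /(star_closed_commutant hS)[]//|].
apply/seteqP; split=> a [ba aS]; split=> // b.
  by move=> [_ bS]; rewrite bS.
by move=> Sb; apply: aS; split=> [|c [_ cS]]; [case: (hS _ Sb)|rewrite cS].
Qed.

Section VonNeumann.
Variables (M : set (H -> H)) (vM : von_neumann M).

Lemma vn_star : star_closed M.
Proof. by case: vM => Ma ME a Ma'; split; [rewrite ME in Ma'; case: Ma'|exact: Ma]. Qed.

Let cM : star_closed (commutant M) := star_closed_commutant vn_star.

Lemma vn_bounded a : M a -> bounded_operator a.
Proof. by case/vn_star. Qed.

Lemma vn_adj a : M a -> M (adj a).
Proof. by case/vn_star. Qed.

Lemma vn_comp a b : M a -> M b -> M (a \o b).
Proof. by case: vM => _ -> Ma Mb; exact: commutant_comp. Qed.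

Lemma vn_add a b : M a -> M b -> M (a \+ b).
Proof. by case: vM => _ -> Ma Mb; exact: commutant_add. Qed.

Lemma vn_scale k : M (fun x => k *: x).
Proof. by case: vM => _ ->; exact: commutant_scale. Qed.

Lemma vn_id : M id.
Proof.
by have := vn_scale 1; congr M; apply/funext => x; rewrite scale1r.
Qed.

End VonNeumann.

(** * Factors *)

Lemma factor_central_idempotent M p : Defs.factor M -> M p -> commutant M p ->
  p \o p = p -> p = 0 \/ p = id.
Proof.
move=> [_ [y /negbTE y0] ctr] Mp M'p; have : (M `&` commutant M) p by [].
rewrite ctr => -[k ->] /comp_app/(_ y) /eqP.
rewrite scalerA -subr_eq0 -scalerBl scaler_eq0 y0 orbF.
rewrite -[X in _ - X](mulr1 k) -mulrBr mulf_eq0 subr_eq0 => /orP[] /eqP ->.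
  by left; apply/funext => x; rewrite scale0r.
by right; apply/funext => x; rewrite scale1r.
Qed.

(** The vectors orthogonal to [MwH] form a closed subspace [L] that [M] and its
    commutant preserve; hence the projection onto [L] is central, and [L] is
    [0] or [H].  The hypothesis puts the range of [adj z] in [L], so [z = 0] in
    the first case; in the second, [wH] is orthogonal to itself. *)
Lemma factor_prime M (z w : H -> H) : Defs.factor M -> M z -> M w ->
  (forall a, M a -> z \o a \o w = 0) -> z = 0 \/ w = 0.
Proof.
move=> fM Mz Mw zMw; have [vM _ _] := fM.
pose L := [set y | forall a, M a -> forall x, inner H y (a (w x)) = 0].
have HL : closed_subspace L.
  split=> /=.
  - by move=> a Ma x; rewrite inner0l.
  - by move=> x y Lx Ly a Ma v; rewrite innerDl Lx// Ly// addr0.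
  - by move=> k x Lx a Ma v; rewrite innerZl Lx// mulr0.
  move=> y yL a Ma x; apply: inner_rip0 => k; set s := k *: _.
  apply: (small_eq0 (sqn_ge0 s)) => t e e0; have [v Lv vy] := yL _ e0.
  have -> : rip y s = rip (y - v) s.
    by rewrite ripBl /rip [X in _ - complex.Re X]innerZr Lv// mulr0 subr0.
  by apply: le_trans (rip_young _ _ _) _; rewrite lerD2r sqn_sub ltW.
have [P [bP LP PL Pc]] := orthogonal_projection HL.
have ML c y : M c -> L y -> L (c y).
  move=> Mc Ly a Ma x; rewrite (adjP (vn_bounded vM Mc)).
  by apply: (Ly (adj c \o a)); apply: vn_comp => //; exact: vn_adj.
have M'L c y : commutant M c -> L y -> L (c y).
  move=> /(star_closed_commutant (vn_star vM))[bc [_ cM]] Ly a Ma x.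
  by rewrite (adjP bc) (comp_app (cM _ Ma)) /= (comp_app (cM _ Mw)) Ly.
have MP : M P.
  case: (vM) => _ ->; split=> // c Mc.
  have [bc Mac] := star_closed_commutant (vn_star vM) Mc.
  by rewrite Pc// => y; exact: M'L.
have M'P : commutant M P.
  split=> // c Mc; rewrite Pc//; first exact: vn_bounded Mc.
    by move=> y; exact: ML.
  by move=> y; apply: ML; exact: vn_adj.
have PP : P \o P = P by apply/funext => y; exact: PL.
have [P0|P1] := factor_central_idempotent fM MP M'P PP; [left|right].
  have za y : adj z y = 0.
    rewrite -[LHS]PL ?P0// => a Ma x.
    rewrite -(adjK (vn_bounded vM Mz)) in zMw.
    rewrite (adjP (bounded_adj (vn_bounded vM Mz))).
    by have /(congr1 (fun f => f x)) /= -> := zMw _ Ma; rewrite inner0r.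
  rewrite -(adjK (vn_bounded vM Mz)); apply: adj_eq.
    exact/bounded_adj/(vn_bounded vM).
  by move=> x y; rewrite za inner0l inner0r.
apply/funext => x; apply: inner_eq0.
suff Lwx : L (w x) by exact: (Lwx _ (vn_id vM)).
by rewrite -[w x]/(id (w x)) -P1; exact: LP.
Qed.

End Commutants.

(** * Projections in a von Neumann algebra *)

Section Projections.
Variables (R : realType) (H : hilbertType R) (M : set (H -> H)).
Hypothesis vM : von_neumann M.
Implicit Types (a b e p q r u : H -> H).

Definition compl p : H -> H := fun y => y - p y.

Lemma compl_projection p : projection M p -> projection M (compl p).
Proof.
move=> [Mp ap pp]; have bp := vn_bounded vM Mp.
have pE : compl p = id \+ ((fun x => (-1) *: x) \o p).
  by apply/funext => y; rewrite /compl /= scaleN1r.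
split.
- rewrite pE; apply: vn_add => //; first exact: vn_id.
  by apply: vn_comp => //; exact: vn_scale.
- apply: adj_eq; last first.
    by move=> x y; rewrite /compl innerBl innerBr (adjP bp) ap.
  rewrite pE; apply: bounded_add; first exact: bounded_id.
  by apply: bounded_comp => //; exact: bounded_scale.
- by apply/funext => y; rewrite /compl /= (bopB bp) (comp_app pp) subrr subr0.
Qed.

Lemma conj_projection u p : M u -> Defs.unitary u -> projection M p ->
  projection M (u \o p \o adj u).
Proof.
move=> Mu [u1 u2] [Mp ap pp].
have [bp bu bu'] : [/\ bounded_operator p, bounded_operator u & bounded_operator (adj u)].
  by split; apply: (vn_bounded vM) => //; exact: vn_adj.
split.
- by do ?[apply: vn_comp => //]; exact: vn_adj.
- by rewrite (adj_comp (bounded_comp bu bp) bu') (adj_comp bu bp) ap (adjK bu).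
- by apply/funext => y /=; rewrite (comp_app u1) (comp_app pp).
Qed.

(** A form of the statement that the corner [pMp] of a factor is a factor: as
    [e] commutes with [pMp], one has [(ep) M ((1-e)p) = 0]. *)
Lemma corner_factor e p : Defs.factor M -> projection M e -> projection M p ->
  (forall a, M a -> e \o (p \o a \o p) = (p \o a \o p) \o e) ->
  e \o p = p \o e -> e \o p = 0 \/ e \o p = p.
Proof.
move=> fM pe pp eC ep; have [Me _ ee] := pe; have [Mp _ ppp] := pp.
have [Me' _ _] := compl_projection pe; have be := vn_bounded vM Me.
have bp := vn_bounded vM Mp.
have [] := @factor_prime _ _ M (e \o p) (compl e \o p) fM.
- exact: vn_comp.
- exact: vn_comp.
- move=> a Ma; apply/funext => y /=; have ba := vn_bounded vM Ma.
  have ce : compl e (p y) = p (compl e y).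
    by rewrite /compl (bopB bp) (comp_app ep).
  rewrite ce; have := comp_app (eC _ Ma) (compl e y) => /= ->.
  by rewrite /compl (bopB be) (comp_app ee) subrr !bop0.
- by left.
move=> h; right; apply/funext => y; apply/esym/subr0_eq.
by have := congr1 (fun f => f y) h.
Qed.

End Projections.

(** * A projection not conjugate to its complement *)

Section AsymmetricProjection.
Variables (R : realType) (H : hilbertType R) (M : set (H -> H)).

Lemma id_neq0 : Defs.factor M -> (@id H) <> 0.
Proof.
by move=> [_ [y /eqP y0] _] /(congr1 (fun f => f y)).
Qed.

Lemma id_projection : von_neumann M -> projection M id.
Proof. by move=> vM; split=> //; [exact: vn_id|exact: adj_id]. Qed.

Lemma nonminimal e : projection M e -> e <> 0 -> ~ minimal_projection M e ->
  exists q, [/\ subprojection M q e, q <> 0 & q <> e].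
Proof.
move=> pe e0 emin; apply/not_existsP => h; apply: emin; split=> // q qe.
have [->|q0] := pselect (q = 0); first by left.
have [->|qe'] := pselect (q = e); first by right.
by case: (h q).
Qed.

(** In a finite algebra no unitary carries [q] below a proper subprojection [r]:
    given such a [u], the isometry [s = uq + (1-q)] is unitary by finiteness,
    but its range lies in that of [r + (1-q)], so that [(q - r) s = 0]. *)
Lemma no_unitary_into_smaller q r u : von_neumann M -> finite_projection M id ->
  projection M q -> subprojection M r q -> M u -> Defs.unitary u ->
  (forall x, r (u (q x)) = u (q x)) -> r = q.
Proof.
move=> vM [_ fin] pq [pr qr] Mu [u1 u2] ruq.
have [Mq aq qq] := pq; have [Mr ar _] := pr.
have [Mq' aq' qq'] := compl_projection vM pq.
have Mu' := vn_adj vM Mu.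
have [bq bu bu'] : [/\ bounded_operator q, bounded_operator u & bounded_operator (adj u)].
  by split; exact: (vn_bounded vM).
have bq' := vn_bounded vM Mq'; have br := vn_bounded vM Mr.
have rq : r \o q = r by rewrite -[RHS]ar -[in RHS]qr (adj_comp bq br) ar aq.
pose s := (u \o q) \+ compl q.
have Ms : M s by apply: vn_add => //; exact: vn_comp.
have sE : adj s = (q \o adj u) \+ compl q.
  by rewrite (adj_add (bounded_comp bu bq) bq') (adj_comp bu bq) aq aq'.
have quq x : q (u (q x)) = u (q x).
  by rewrite -(ruq x) (comp_app qr).
have q'uq x : compl q (u (q x)) = 0 by rewrite /compl quq subrr.
have qq'0 x : q (compl q x) = 0 by rewrite /compl (bopB bq) (comp_app qq) subrr.
have uqq' x : q (adj u (compl q x)) = 0.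
  have := adjP bq; have := adjP bq'; rewrite aq aq' => q'P qP.
  apply: inner_sepr => z.
  by rewrite -qP -(adjP bu) -q'P q'uq inner0l inner0r.
have s1 : adj s \o s = id.
  apply/funext => x; rewrite sE /s /= (bopD bu') (bopD bq) (bopD bq').
  rewrite (comp_app u1) (comp_app qq) q'uq add0r (comp_app qq') uqq' addr0.
  by rewrite /compl addrC subrK.
have se : s \o adj s = id.
  apply: (fin (s \o adj s)).
    split=> //; split.
    - by apply: vn_comp => //; exact: vn_adj.
    - have bs := vn_bounded vM Ms.
      by rewrite (adj_comp bs (bounded_adj bs)) (adjK bs).
    - by apply/funext => y /=; rewrite (comp_app s1).
  by exists s.
apply/esym/funext => x; apply/subr0_eq.
have qrs y : q (s y) - r (s y) = 0.
  rewrite /s /= (bopD bq) (bopD br) quq ruq qq'0 addr0.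
  by rewrite -[r (compl q y)](comp_app rq) qq'0 (bop0 br) addr0 subrr.
by have := qrs (adj s x); rewrite (comp_app se).
Qed.

Lemma ex_asymmetric_projection : type_II1_factor M ->
  exists p, [/\ projection M p, p <> 0, p <> id &
    forall u, M u -> Defs.unitary u -> u \o p \o adj u <> compl p].
Proof.
move=> [fM nomin fin]; have vM : von_neumann M by case: fM.
apply: contrapT => none.
have sym p : projection M p -> p <> 0 -> p <> id ->
    exists u, [/\ M u, Defs.unitary u & u \o p \o adj u = compl p].
  move=> pp p0 p1; apply/not_existsP => h; apply: none.
  by exists p; split=> // u Mu uu up; case: (h u).
have nonmin e : projection M e -> e <> 0 ->
    exists q, [/\ subprojection M q e, q <> 0 & q <> e].
  by move=> pe e0; apply: nonminimal => // emin; apply: nomin; exists e.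
have [q [[pq _] q0 q1]] := nonmin _ (id_projection vM) (id_neq0 fM).
have [r [rq r0 r1]] := nonmin _ pq q0; have [pr qr] := rq.
have [u [Mu [u1 u2] uq]] := sym _ pq q0 q1.
have [w [Mw [w1 w2] wr]] : exists u, [/\ M u, Defs.unitary u & u \o r \o adj u = compl r].
  apply: sym => // r1'; apply: q1; by rewrite -[RHS]r1' -qr r1'.
have [Mq aq qq] := pq; have [Mr ar rr] := pr.
have [bq br bu bw] : [/\ bounded_operator q, bounded_operator r,
    bounded_operator u & bounded_operator w].
  by split; exact: (vn_bounded vM).
have bu' := bounded_adj bu; have bw' := bounded_adj bw.
have rq' : r \o q = r by rewrite -[RHS]ar -[in RHS]qr (adj_comp bq br) ar aq.
(* [w] maps [r] onto [1-r] and [u] maps [q] onto [1-q <= 1-r], so [w* u] maps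
   [q] below [r]. *)
apply: r1; apply: (@no_unitary_into_smaller q r (adj w \o u)) => //.
- by apply: vn_comp => //; exact: vn_adj.
- rewrite /Defs.unitary (adj_comp bw' bu) (adjK bw); split; apply/funext => x /=.
    by rewrite (comp_app w2) (comp_app u1).
  by rewrite (comp_app u2) (comp_app w1).
move=> x /=.
have uqE : u (q x) = compl q (u x) by rewrite -(comp_app uq) /= (comp_app u1).
have rwE y : r (adj w y) = adj w (compl r y).
  by rewrite -(comp_app wr) /= (comp_app w1).
by rewrite rwE uqE; congr (adj w _); rewrite /compl (bopB br) (comp_app rq') subrr subr0.
Qed.

End AsymmetricProjection.

(** * The block diagonal algebra of a projection *)

Section RelativeCommutant.
Variables (R : realType) (H : hilbertType R) (M : set (H -> H)) (p : H -> H).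
Hypotheses (vM : von_neumann M) (pp : projection M p).

Definition relative_commutant : set (H -> H) := [set a | M a /\ a \o p = p \o a].
Local Notation B := relative_commutant.

Let Mp : M p. Proof. by case: pp. Qed.
Let ap : adj p = p. Proof. by case: pp. Qed.
Let ppE : p \o p = p. Proof. by case: pp. Qed.
Let bp : bounded_operator p := vn_bounded vM Mp.

Lemma relative_commutant_vn : von_neumann_subalgebra B M.
Proof.
split; last by move=> a [].
have -> : B = commutant (commutant M `|` [set p]).
  apply/seteqP; split=> a.
    move=> [Ma apa]; split; first exact: (vn_bounded vM).
    by move=> b [[_ ->]|->].
  move=> [ba aS]; split; last by apply: aS; right.
  by case: vM => _ ->; split=> // b Mb; apply: aS; left.
apply: von_neumann_commutant => a [|->].
  by move=> /(star_closed_commutant (vn_star vM))[? ?]; split=> //; left.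
by rewrite ap; split=> //; right.
Qed.

Lemma corner_relative_commutant b : M b ->
  B (p \o b \o p) /\ B (compl p \o b \o compl p).
Proof.
move=> Mb; have [Mp' _ _] := compl_projection vM pp.
have bb := vn_bounded vM Mb.
split; split; try (by do ?[apply: vn_comp => //]); apply/funext => y /=.
  by rewrite !(comp_app ppE).
have cp x : compl p (p x) = 0 by rewrite /compl (comp_app ppE) subrr.
have pc x : p (compl p x) = 0 by rewrite /compl (bopB bp) (comp_app ppE) subrr.
by rewrite cp pc !bop0//; exact: (vn_bounded vM).
Qed.

(** With [n = qar], the outer factors of [n b n* = q (a r b r a* ) q] put it in
    [qMq], and those of [n* b n] put it in [rMr]. *)
Lemma corner_normaliser q r a : projection M q -> projection M r ->
  (forall b, M b -> B (q \o b \o q)) -> (forall b, M b -> B (r \o b \o r)) ->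
  M a -> normaliser M B (q \o a \o r).
Proof.
move=> [Mq aq _] [Mr ar _] qB rB Ma; have Ma' := vn_adj vM Ma.
have nE : adj (q \o a \o r) = r \o adj a \o q.
  have bq := vn_bounded vM Mq; have br := vn_bounded vM Mr.
  have ba := vn_bounded vM Ma.
  by rewrite (adj_comp (bounded_comp bq ba) br) (adj_comp bq ba) aq ar.
split; first by do ?[apply: vn_comp => //].
rewrite nE => _ [] [b [Mb _] <-].
  by apply: (qB (a \o (r \o b \o r) \o adj a)); do ?[apply: vn_comp => //].
by apply: (rB (adj a \o (q \o b \o q) \o a)); do ?[apply: vn_comp => //].
Qed.

Lemma relative_commutant_regular : regular M B.
Proof.
have pp' := compl_projection vM pp.
have pB b : M b -> B (p \o b \o p) by case/corner_relative_commutant.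
have p'B b : M b -> B (compl p \o b \o compl p) by case/corner_relative_commutant.
apply/seteqP; split=> [a|a Ma N [[vN _] nN]].
  by apply; split=> [|b []//]; split.
have Nc q r : projection M q -> projection M r ->
    (forall b, M b -> B (q \o b \o q)) -> (forall b, M b -> B (r \o b \o r)) ->
    N (q \o a \o r).
  by move=> *; apply/nN/corner_normaliser.
have -> : a = ((p \o a \o p) \+ (p \o a \o compl p)) \+
    ((compl p \o a \o p) \+ (compl p \o a \o compl p)).
  have ba := vn_bounded vM Ma.
  have bp' : bounded_operator (compl p) by case: pp' => /(vn_bounded vM).
  apply/funext => x /=; rewrite -(bopD bp) -(bopD bp') -(bopD ba).
  by rewrite /compl !subrKC.
by apply: (vn_add vN); apply: (vn_add vN); exact: Nc.
Qed.

Hypotheses (fM : Defs.factor M) (p0 : p <> 0) (p1 : p <> id).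

Lemma relative_commutant_central e : projection M e -> B e ->
  (forall b, B b -> e \o b = b \o e) ->
  [\/ e = 0, e = id, e = p | e = compl p].
Proof.
move=> pe [Me ep] eC; have pp' := compl_projection vM pp.
have be := vn_bounded vM Me.
have eC1 a : M a -> e \o (p \o a \o p) = (p \o a \o p) \o e.
  by case/corner_relative_commutant => ? _; exact: eC.
have eC2 a : M a -> e \o (compl p \o a \o compl p) = (compl p \o a \o compl p) \o e.
  by case/corner_relative_commutant => _ ?; exact: eC.
have ep' : e \o compl p = compl p \o e.
  by apply/funext => x; rewrite /compl /= (bopB be) (comp_app ep).
have eE x : e x = e (p x) + e (compl p x).
  by rewrite -(bopD be) /compl addrC subrK.
have [h|h] := corner_factor vM fM pe pp eC1 ep;
have [h'|h'] := corner_factor vM fM pe pp' eC2 ep';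
  [apply: Or41|apply: Or44|apply: Or43|apply: Or42]; apply/funext => x;
  rewrite eE (comp_app h) (comp_app h') /=.
- by rewrite addr0.
- by rewrite add0r.
- by rewrite addr0.
- by rewrite /compl addrC subrK.
Qed.

Hypothesis asym :
  forall u, M u -> Defs.unitary u -> u \o p \o adj u <> compl p.

(** Conjugation by a normalising unitary is an automorphism of [B], so it maps
    the central projection [p] to a central projection of [B]. *)
Lemma unitary_normaliser_sub : unitary_normaliser M B `<=` B.
Proof.
move=> u [Mu uu uB]; split=> //; have [u1 u2] := uu.
have bu := vn_bounded vM Mu.
set e := u \o p \o adj u.
have Bp : B p by split.
have Be : B e by rewrite -uB; exists p.
have eC b : B b -> e \o b = b \o e.
  rewrite -{1}uB => -[c [_ cp] <-]; apply/funext => x; rewrite /e /=.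
  by rewrite !(comp_app u1) (comp_app cp).
have pe : projection M e by exact: conj_projection.
have pE x : p x = adj u (e (u x)) by rewrite /e /= !(comp_app u1).
have bu' := bounded_adj bu.
case: (relative_commutant_central pe Be eC) => eE.
- by case: p0; apply/funext => x; rewrite pE eE /= bop0.
- by case: p1; apply/funext => x; rewrite pE eE /= (comp_app u1).
- apply/funext => x; have : u (p x) = e (u x) by rewrite /e /= (comp_app u1).
  by rewrite eE.
- by case: (asym Mu uu).
Qed.

Lemma relative_commutant_not_unitarily_regular : ~ unitarily_regular M B.
Proof.
move=> uM.
have MB a : M a -> B a.
  rewrite -{1}uM; apply; split; first exact: relative_commutant_vn.
  exact: unitary_normaliser_sub.
have M'p : commutant M p by split=> // b /MB[_ ->].
by case: (factor_central_idempotent fM Mp M'p ppE).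
Qed.

End RelativeCommutant.

Theorem corollary3p7 (R : realType) (H : hilbertType R) (M : set (H -> H))
    (hM : type_II1_factor M) :
  exists B : set (H -> H),
    [/\ von_neumann_subalgebra B M, regular M B & ~ unitarily_regular M B].
Proof.
have [p [pp p0 p1 asym]] := ex_asymmetric_projection hM.
have [fM _ _] := hM; have [vM _ _] := fM.
exists (relative_commutant M p); split.
- exact: relative_commutant_vn.
- exact: relative_commutant_regular.
- exact: relative_commutant_not_unitarily_regular.
Qed.
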